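(* Let $q$ be a prime power, $m,k$ positive integers and $\rho\in\{1,\ldots,\min\{k,m\}\}$. Then: (a) if $\rho<\min\{k,m\}$, then $s_{q^m/q}(k,\rho+1)\le s_{q^m/q}(k,\rho)$; (b) $s_{q^m/q}(k,\rho)\le s_{q^m/q}(k+1,\rho)-1$; (c) if $\rho<m$, then $s_{q^m/q}(k+1,\rho+1)\le s_{q^m/q}(k,\rho)+1$.
   Context: An $[n,k]_{q^m/q}$ system is an $n$-dimensional $\mathbb{F}_q$-subspace $\mathcal{U}\le\mathbb{F}_{q^m}^k$ with $\langle\mathcal{U}\rangle_{\mathbb{F}_{q^m}}=\mathbb{F}_{q^m}^k$; its linear set is $L_\mathcal{U}=\{\langle u\rangle_{\mathbb{F}_{q^m}}:u\in\mathcal{U}\setminus\{0\}\}\subseteq\mathrm{PG}(k-1,q^m)$. A point set $\mathcal{S}$ of $\mathrm{PG}(k-1,q^m)$ is $r$-saturating if every point lies in the span of some $r+1$ points of $\mathcal{S}$ and $r$ is minimal with this property; $\mathcal{U}$ is rank-$\rho$-saturating if $L_\mathcal{U}$ is $(\rho-1)$-saturating. For $\rho\in\{1,\ldots,\min\{k,m\}\}$, $s_{q^m/q}(k,\rho)$ is the minimum $n$ such that an $[n,k]_{q^m/q}$ rank-$\rho$-saturating system exists. *)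

(* Defs.v *)
From HB Require Import structures.
From mathcomp Require Import all_boot all_order all_algebra all_field.
From mathcomp Require Import boolp.
Set Implicit Arguments.
Unset Strict Implicit.
Unset Printing Implicit Defensive.
Import GRing.Theory.
Local Open Scope ring_scope.

Section RankSaturating.

Variables (F : finFieldType) (L : fieldExtType F).

(* L^k is used in two guises: {ffun 'I_k -> L}, whose canonical vector space
   structure is the one over F, and 'rV[L]_k, whose canonical structure is the
   one over L.  The map below identifies them. *)
Definition row_of (k : nat) (u : {ffun 'I_k -> L}) : 'rV[L]_k := \row_i u i.

(* The last clause says that the smallest L-subspace containing U is L^k. *)
Definition is_system (n k : nat) (U : {vspace {ffun 'I_k -> L}}) : Prop :=
  \dim U = n /\
  forall V : {vspace 'rV[L]_k},
    (forall u, u \in U -> row_of u \in V) -> V = fullv.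

Definition is_point (k : nat) (P : {vspace 'rV[L]_k}) : Prop := \dim P = 1%N.

Definition linear_set (k : nat) (U : {vspace {ffun 'I_k -> L}})
    (P : {vspace 'rV[L]_k}) : Prop :=
  exists u, [/\ u \in U, u != 0 & P = <[row_of u]>%VS].

(* The r.+1 points need not be distinct.  The minimal r below is the same as
   with distinct points: a point that is not in the span of any r points of S
   forces S to have at least r.+1 points. *)
Definition covers (k : nat) (S : {vspace 'rV[L]_k} -> Prop) (r : nat) : Prop :=
  forall P, is_point P ->
    exists Q : 'I_r.+1 -> {vspace 'rV[L]_k},
      (forall i, S (Q i)) /\ (P <= \sum_i Q i)%VS.

Definition saturating (k : nat) (S : {vspace 'rV[L]_k} -> Prop) (r : nat) :
    Prop :=
  covers S r /\ forall r', covers S r' -> (r <= r')%N.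

(* Meaningful for 0 < rho only, because of the truncated predecessor. *)
Definition rank_saturating (k : nat) (U : {vspace {ffun 'I_k -> L}})
    (rho : nat) : Prop :=
  saturating (linear_set U) rho.-1.

Definition has_system (k rho n : nat) : Prop :=
  exists U : {vspace {ffun 'I_k -> L}}, is_system n U /\ rank_saturating U rho.

(* The default value 0 is not reached when 0 < rho <= minn k (\dim {:L}), see
   sminP. *)
Definition smin (k rho : nat) : nat :=
  if pselect (exists n, `[< has_system k rho n >]) is left h
  then ex_minn h else 0%N.

(* The vectors whose first rho coordinates lie in F (1%VS is F inside L); they
   form a rank-rho-saturating system, the witness of smin_exists. *)
Definition sysU (k rho : nat) : {vspace {ffun 'I_k -> L}} :=
  (\bigcap_(i < k | (i < rho)%N)
     (linfun (fun u : {ffun 'I_k -> L} => u i) @^-1: 1%VS))%VS.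

Lemma mem_sysU k rho (u : {ffun 'I_k -> L}) :
  reflect (forall i : 'I_k, (i < rho)%N -> u i \in 1%VS) (u \in sysU k rho).
Proof.
have lin (i : 'I_k) (v : {ffun 'I_k -> L}) :
    linfun (fun u : {ffun 'I_k -> L} => u i) v = v i.
  pose f (u : {ffun 'I_k -> L}) := u i.
  have fl : linear f by move=> a x y; rewrite /f !ffunE.
  pose fL := GRing.isLinear.Build F {ffun 'I_k -> L} L _ f fl.
  pose g : {linear {ffun 'I_k -> L} -> L} := HB.pack f fL.
  exact: (lfunE g v).
apply: (iffP idP).
  rewrite memvE => /subv_bigcapP h i hi.
  by have := h i hi; rewrite -memvE -memv_preim lin.
move=> h; rewrite memvE; apply/subv_bigcapP => i hi.
by rewrite -memvE -memv_preim lin h.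
Qed.

Lemma smin_exists (k rho : nat) :
  (0 < rho <= minn k (\dim {:L}))%N -> exists n, has_system k rho n.
Proof.
case: rho => // rho; rewrite ltnS leq_min => /and3P[_ hk hm].
pose U := sysU k rho.+1; pose w := widen_ord hk.
exists (\dim U), U; split; [split=> // V hV|split].
- apply/eqP; rewrite eqEsubv subvf; apply/subvP => v _.
  rewrite (row_sum_delta v); apply: memv_suml => i _; apply: memvZ.
  have -> : delta_mx 0 i = row_of [ffun j => (j == i)%:R].
    by apply/rowP => j; rewrite !mxE !ffunE.
  by apply/hV/mem_sysU => j _; rewrite ffunE; case: eqP; rewrite ?mem1v ?mem0v.
- move=> P Pp; pose v := vpick P.
  have v0 : v != 0.
    by rewrite vpick0; apply: contra_eqN Pp => /eqP->; rewrite dimv0.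
  have -> : P = <[v]>%VS.
    by apply/esym/eqP; rewrite eqEdim -memvE memv_pick dim_vline v0 Pp.
  have [j0 hj0|h0] := pickP (fun j : 'I_rho.+1 => v 0 (w j) != 0); last first.
    have rv : row_of [ffun j => v 0 j] = v.
      by apply/rowP => j; rewrite !mxE !ffunE.
    exists (fun=> <[v]>%VS); split; last exact: (sumv_sup ord0).
    move=> i; exists [ffun j => v 0 j]; split; last by rewrite rv.
      apply/mem_sysU => j hj; rewrite ffunE.
      have /negbFE/eqP := h0 (Ordinal hj).
      by rewrite (_ : w _ = j) => [->|]; [rewrite mem0v | apply/val_inj].
    apply: contra v0 => /eqP e0; rewrite -rv e0.
    by apply/eqP/rowP => j; rewrite !mxE ffunE.
  pose u (j : 'I_rho.+1) : {ffun 'I_k -> L} :=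
    [ffun i : 'I_k => if (i < rho.+1)%N then (i == w j)%:R
                      else if j == j0 then v 0 i / v 0 (w j0) else 0].
  exists (fun j => <[row_of (u j)]>%VS); split=> [j|].
    exists (u j); split=> //.
      apply/mem_sysU => i hi; rewrite ffunE hi.
      by case: eqP; rewrite ?mem1v ?mem0v.
    apply/eqP => /ffunP/(_ (w j)); rewrite !ffunE /= ltn_ord eqxx.
    by move/eqP; rewrite oner_eq0.
  rewrite -memvE; apply/memv_sumP.
  exists (fun j => v 0 (w j) *: row_of (u j)) => [j _|].
    by rewrite memvZ ?memv_line.
  apply/rowP => i; rewrite summxE.
  have [hi|/negbTE hi] := boolP (i < rho.+1)%N;
    under eq_bigr => j _ do rewrite !mxE ffunE hi.
    have ei : i = w (Ordinal hi) by apply/val_inj.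
    rewrite (bigD1 (Ordinal hi)) //= -ei eqxx mulr1 big1 ?addr0 // => j jn.
    rewrite (_ : _ == _ = false) ?mulr0 //; apply: contraNF jn => /eqP e.
    by apply/eqP/val_inj; rewrite /= e.
  rewrite (bigD1 j0) //= eqxx mulrC divfK // big1 ?addr0 // => j /negbTE->.
  by rewrite mulr0.
- move=> r hr /=; have bf := basis_free (vbasisP {:L}).
  pose b := [ffun i : 'I_k => if (i < rho.+1)%N then (vbasis {:L})`_i else 0].
  have b0 : b (w ord0) != 0.
    rewrite ffunE /=; apply: (free_not0 bf).
    by rewrite mem_nth // size_tuple (leq_trans _ hm).
  have [|Q [hQ]] := hr <[row_of b]>%VS.
    rewrite /is_point dim_vline; suff -> : row_of b != 0 by [].
    by apply: contraNneq b0 => /rowP/(_ (w ord0)); rewrite !mxE => ->.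
  rewrite -memvE => /memv_sumP[vs hvs e].
  have /fin_all_exists[c hc] i : exists c : L * {ffun 'I_k -> L},
      c.2 \in U /\ vs i = c.1 *: row_of c.2.
    have [u [uU _ Qu]] := hQ i.
    by have := hvs i isT; rewrite Qu => /vlineP[a ->]; exists (a, u).
  pose l := [seq (c i).1 | i <- enum 'I_r.+1].
  have sub : (<<take rho.+1 (vbasis {:L})>> <= <<l>>)%VS.
    apply/span_subvP => x /(nthP 0)[i].
    rewrite size_take size_tuple => hi <-.
    have {}hi : (i < rho.+1)%N.
      by move: hi; case: ifPn => // hn hi; rewrite (leq_trans hi) // leqNgt.
    rewrite nth_take //.
    have := congr1 (fun A : 'rV[L]_k => A 0 (w (Ordinal hi))) e.
    rewrite /= mxE ffunE /= hi => ->; rewrite summxE memv_suml // => j _.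
    have [cU ->] := hc j; rewrite !mxE.
    have /mem_sysU/(_ (w (Ordinal hi)) hi)/vlineP[a ->] := cU.
    rewrite -scalerAr mulr1; apply/memvZ/memv_span/mapP.
    by exists j; rewrite ?mem_enum.
  have ft : free (take rho.+1 (vbasis {:L})).
    by move: bf; rewrite -{1}(cat_take_drop rho.+1 (vbasis {:L})) => /catl_free.
  have := leq_trans (dimvS sub) (dim_span l).
  by rewrite (eqnP ft) size_map size_enum_ord size_takel ?size_tuple.
Qed.

Lemma sminP (k rho : nat) : (0 < rho <= minn k (\dim {:L}))%N ->
  has_system k rho (smin k rho) /\
  forall n, has_system k rho n -> (smin k rho <= n)%N.
Proof.
move=> /smin_exists[n0 h0]; rewrite /smin; case: pselect => [h|[]].
  case: ex_minnP => n /asboolP hn min; split=> // n' /asboolP; exact: min.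
by exists n0; apply/asboolP.
Qed.

End RankSaturating.

(* Main.v *)
(** A system of dimension [n] is described by the [n x k] matrix [G] whose rows
    are an F-basis of it.  If every vector of L^k is an L-combination of [rho]
    vectors of the system, then the theorem's bounds come from three operations
    on [G] (doing nothing, projecting from a row, adding a unit vector), each of
    which gives a matrix covering with the required number of vectors.  The point
    is that the definition of [smin] asks for the minimal such number to be
    exactly [rho].  Multiplying one row of [G] by a nonzero scalar of L increases
    the minimal number by at most one.  So if no matrix with at most [n] rows has
    minimal number [t + 1], a matrix covering with [t] vectors keeps doing so
    after any rescaling of its rows.  If its rows are L-dependent, a rescaling
    makes them F-dependent and a row can be deleted.  Hence one reaches an
    L-basis of L^k, whose minimal number is [min (k, m) > t], a contradiction. *)
Require Import Defs.
From mathcomp Require Import all_boot all_order all_algebra all_field.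
From mathcomp Require Import boolp.
Set Implicit Arguments.
Unset Strict Implicit.
Unset Printing Implicit Defensive.
Import GRing.Theory.
Local Open Scope ring_scope.

(** * Covering L^k by F-combinations of the rows of a matrix *)

Section RankCovering.

Variables (F : fieldType) (L : fieldExtType F).

Local Notation "A ^L" := (map_mx (in_alg L) A) (at level 8, format "A ^L").

(* The rows of A^L *m G are t vectors of the F-span of the rows of G. *)
Definition rank_covering (n k : nat) (G : 'M[L]_(n, k)) (t : nat) : Prop :=
  forall v : 'rV[L]_k, exists (c : 'rV[L]_t) (A : 'M[F]_(t, n)),
    v = c *m A^L *m G.

Lemma rank_coveringW n k (G : 'M[L]_(n, k)) s t :
  (s <= t)%N -> rank_covering G s -> rank_covering G t.
Proof.
move=> /subnKC <- hG v; have [c [A ->]] := hG v.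
exists (row_mx c 0), (col_mx A 0).
by rewrite map_col_mx mul_row_col mul0mx addr0.
Qed.

Lemma rank_covering_factor n p k (B : 'M[F]_(n, p)) (G : 'M[L]_(p, k)) t :
  rank_covering (B^L *m G) t -> rank_covering G t.
Proof.
move=> hG v; have [c [A ->]] := hG v; exists c, (A *m B).
by rewrite map_mxM !mulmxA.
Qed.

Lemma rank_covering_mulmxr n k l (G : 'M[L]_(n, k)) (M : 'M[L]_(k, l))
    (N : 'M[L]_(l, k)) t :
  N *m M = 1%:M -> rank_covering G t -> rank_covering (G *m M) t.
Proof.
move=> NM hG v; have [c [A e]] := hG (v *m N); exists c, A.
by rewrite mulmxA -e -mulmxA NM mulmx1.
Qed.

Lemma rank_covering_row_full n k (G : 'M[L]_(n, k)) t :
  rank_covering G t -> row_full G.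
Proof.
move=> hG; rewrite -sub1mx; apply/row_subP => i.
by have [c [A ->]] := hG (row i 1%:M); rewrite submxMl.
Qed.

(** An F-relation whose coefficient at [i] is nonzero puts row [i] in the F-span of the other rows;
    [B] holds the resulting coefficients. *)
Lemma rank_covering_row' n k (G : 'M[L]_(n.+1, k)) (y : 'rV[F]_n.+1) i t :
  y^L *m G = 0 -> y 0 i != 0 ->
  rank_covering G t -> rank_covering (row' i G) t.
Proof.
move=> yG yi hG.
pose B : 'M[F]_(n.+1, n) :=
  \matrix_(h, j) (if h == i then - (y 0 (lift i j) / y 0 i)
                  else (h == lift i j)%:R).
apply: (@rank_covering_factor _ _ _ B); suff <- : G = B^L *m row' i G by [].
apply/matrixP => h l; rewrite mxE.
have [->|hi] := eqVneq h i; last first.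
  case: (unliftP i h) hi => [h' ->|->]; last by rewrite eqxx.
  move=> hi; rewrite (bigD1 h') //= !mxE (negbTE hi) eqxx big1 ?addr0.
    by rewrite /= scale1r mul1r.
  move=> j jh; rewrite !mxE (negbTE hi) (inj_eq (@lift_inj _ i)) eq_sym.
  by rewrite (negbTE jh) /= scale0r mul0r.
have := congr1 (fun M : 'rV[L]_k => M 0 l) yG; rewrite !mxE.
rewrite (bigD1_ord i) //= !mxE => /eqP; rewrite addr_eq0 => /eqP e.
have yiL : (y 0 i)%:A != 0 :> L by rewrite scaler_eq0 oner_eq0 orbF.
apply: (mulfI yiL); rewrite e -sumrN mulr_sumr; apply: eq_bigr => j _.
rewrite !mxE eqxx /= scaleNr mulNr mulrN; congr (- _).
by rewrite -!scalerAl !mul1r scalerA mulrC divfK.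
Qed.

(* Only the coefficient of the scaled row changes, so one extra summand
   suffices. *)
Lemma rank_covering_scale_row n k (G : 'M[L]_(n, k)) i (a : L) t :
  a != 0 -> rank_covering G t ->
  rank_covering (diag_mx (\row_j (if j == i then a else 1)) *m G) t.+1.
Proof.
move=> a0 hG v; have [c [A ->]] := hG v; rewrite -(addn1 t).
set x := c *m A^L.
exists (row_mx c (x 0 i * (a^-1 - 1))%:M), (col_mx A (delta_mx 0 i)).
rewrite map_col_mx mul_row_col mulmxA -/x; congr (_ *m G).
apply/rowP => j; rewrite mul_mx_diag !mxE big_ord1 !mxE eqxx mulr1n /=.
have [->|ji] := eqVneq j i; last by rewrite scale0r mulr0 addr0 mulr1.
rewrite scale1r mulr1 mulrBr mulr1 addrC subrK.
by rewrite divfK.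
Qed.

(** Coefficients on L-independent rows are unique. For a vector whose coefficients are F-basis
    elements of L, a covering by [t] vectors would put [t.+1] of these elements in the F-span of the
    [t] entries of [c]. *)
Lemma row_free_not_rank_covering n k (G : 'M[L]_(n, k)) t :
  (t < n)%N -> (t < \dim {:L})%N -> row_free G -> ~ rank_covering G t.
Proof.
move=> tn tL fG hG; have bf := basis_free (vbasisP {:L}).
have [c [A /(row_free_inj fG) e]] := hG ((\row_(i < n) (vbasis {:L})`_i) *m G).
pose l := [seq c 0 j | j <- enum 'I_t].
have sub : (<<take t.+1 (vbasis {:L})>> <= <<l>>)%VS.
  apply/span_subvP => x /(nthP 0)[i].
  rewrite size_takel ?size_tuple // => hi <-; rewrite nth_take //.
  have := congr1 (fun M : 'rV[L]_n => M 0 (Ordinal (leq_trans hi tn))) e.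
  rewrite !mxE /= => ->; apply: memv_suml => j _.
  rewrite !mxE -scalerAr mulr1; apply/memvZ/memv_span/mapP.
  by exists j; rewrite ?mem_enum.
have ft : free (take t.+1 (vbasis {:L})).
  by move: bf; rewrite -{1}(cat_take_drop t.+1 (vbasis {:L})) => /catl_free.
have := leq_trans (dimvS sub) (dim_span l).
by rewrite (eqnP ft) size_map size_enum_ord size_takel ?size_tuple // ltnn.
Qed.

Lemma rank_covering_exact n k (G : 'M[L]_(n, k)) t :
  (t < k)%N -> (t < \dim {:L})%N -> rank_covering G t ->
  exists d (G' : 'M[L]_(d, k)),
    [/\ (d <= n)%N, rank_covering G' t.+1 & ~ rank_covering G' t].
Proof.
move=> tk tL; elim: n G => [|n IHn] G hG.
  have := rank_covering_row_full hG; rewrite /row_full flatmx0 mxrank0.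
  by move=> /eqP kE; rewrite -kE in tk.
have [//|noex] := pselect (exists d (G' : 'M[L]_(d, k)),
    [/\ (d <= n.+1)%N, rank_covering G' t.+1 & ~ rank_covering G' t]).
have drop (G' : 'M[L]_(n.+1, k)) : rank_covering G' t.+1 -> rank_covering G' t.
  by move=> h; apply: contrapT => h'; apply: noex; exists n.+1, G'.
have scaled (a : 'rV[L]_n.+1) : (forall i, a 0 i != 0) ->
    rank_covering (diag_mx a *m G) t.
  move=> a0.
  (* [b r] rescales the first [r] rows only. Each further row may cost one more vector, which [drop]
     takes back. *)
  pose b r : 'rV[L]_n.+1 := \row_i (if (i < r)%N then a 0 i else 1).
  suff bcov r : (r <= n.+1)%N -> rank_covering (diag_mx (b r) *m G) t.
    suff -> : a = b n.+1 by apply: bcov.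
    by apply/rowP => i; rewrite mxE ltn_ord.
  elim: r => [|r IHr] rn.
    suff -> : b 0%N = const_mx 1 by rewrite diag_const_mx mul1mx.
    by apply/rowP => i; rewrite !mxE.
  pose i0 : 'I_n.+1 := Ordinal rn.
  have := drop _ (rank_covering_scale_row i0 (a0 i0) (IHr (ltnW rn))).
  rewrite mulmxA mulmx_diag; congr (rank_covering (diag_mx _ *m G) t).
  apply/rowP => i; rewrite !mxE ltnS (leq_eqVlt i) -(inj_eq val_inj) /=.
  case: eqP => [ir|_] /=; last by rewrite mul1r.
  have -> : i = i0 by apply/val_inj.
  by rewrite ltnn mulr1.
have [fG|] := boolP (row_free G).
  have /eqP kE := rank_covering_row_full hG.
  have kn : (k <= n.+1)%N by rewrite -kE rank_leq_row.
  by case: (row_free_not_rank_covering (leq_trans tk kn) tL fG hG).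
rewrite -kermx_eq0 => /rowV0Pn[z /sub_kermxP zG z0].
have [i zi] : exists i, z 0 i != 0.
  apply: contrapT => h; case/eqP: z0; apply/rowP => i; rewrite mxE.
  by apply/eqP/negPn/negP => zi; apply: h; exists i.
(* Scaling the rows by the coefficients of an L-linear relation turns it into
   an F-linear one. *)
pose a : 'rV[L]_n.+1 := \row_j (if z 0 j == 0 then 1 else z 0 j).
pose y : 'rV[F]_n.+1 := \row_j (z 0 j != 0)%:R.
have yG : y^L *m (diag_mx a *m G) = 0.
  rewrite mulmxA -[RHS]zG; congr (_ *m G); apply/rowP => j.
  rewrite mul_mx_diag !mxE; case: eqP => [->|_] /=.
    by rewrite scale0r mul0r.
  by rewrite scale1r mul1r.
have a0 j : a 0 j != 0.
  by rewrite mxE; case: ifPn; rewrite ?oner_neq0.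
have yi : y 0 i != 0 by rewrite mxE zi oner_neq0.
have [d [G' [dn h1 h2]]] := IHn _ (rank_covering_row' yG yi (scaled a a0)).
by exists d, G'; rewrite (leqW dn).
Qed.

(** Projecting along a line that contains the first row turns this row into zero, and a zero row can
    be deleted. *)
Lemma rank_covering_project n k (G : 'M[L]_(n, k.+1)) t :
  rank_covering G t -> exists G' : 'M[L]_(n.-1, k), rank_covering G' t.
Proof.
case: n G => [|n] G hG.
  by have := rank_covering_row_full hG; rewrite /row_full flatmx0 mxrank0.
(* The rows of [E] form a basis whose first vector spans a line containing [u]. [M] forgets the
   first coordinate in this basis, and [N] is a section of [M]. *)
pose u := row ord0 G; pose E : 'M[L]_(1 + k) := row_ebase u.
pose M : 'M[L]_(1 + k, k) := invmx E *m col_mx 0 1%:M.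
pose N : 'M[L]_(k, 1 + k) := row_mx 0 1%:M *m E.
have NM : N *m M = 1%:M.
  rewrite /M mulmxA mulmxK ?row_ebase_unit //.
  by rewrite mul_row_col mul0mx add0r mulmx1.
have uM : u *m M = 0.
  rewrite -[u]mulmx_ebase /M mulmxA mulmxK ?row_ebase_unit //.
  rewrite -mulmxA; have := rank_leq_row u; case: (\rank u) => [|[|//]] _.
    by rewrite pid_mx_0 mul0mx mulmx0.
  by rewrite (@pid_mx_row _ k 1) mul_row_col mulmx0 mul0mx addr0 mulmx0.
exists (row' ord0 (G *m M)).
apply: (@rank_covering_row' _ _ _ (delta_mx 0 ord0)).
- by rewrite map_delta_mx -rowE row_mul uM.
- by rewrite mxE !eqxx oner_neq0.
- exact: rank_covering_mulmxr NM hG.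
Qed.

(** The added unit vector takes care of the last coordinate with its own coefficient, at the cost of
    one more vector. *)
Lemma rank_covering_block n k (G : 'M[L]_(n, k)) t :
  rank_covering G t ->
  rank_covering (block_mx G 0 0 1%:M : 'M[L]_(n + 1, k + 1)) (t + 1).
Proof.
move=> hG v; have [c [A e]] := hG (lsubmx v).
exists (row_mx c (rsubmx v)), (block_mx A 0 0 1%:M).
rewrite map_block_mx !map_mx0 map_mx1 mul_row_block !mulmx0 mulmx1.
by rewrite add0r addr0 mul_row_block !mulmx0 mulmx1 addr0 add0r -e hsubmxK.
Qed.

End RankCovering.

(** * Translation between systems and matrices *)

Section Systems.

Variables (F : finFieldType) (L : fieldExtType F).

Local Notation "A ^L" := (map_mx (in_alg L) A) (at level 8, format "A ^L").

Definition mx_of d k (X : d.-tuple {ffun 'I_k -> L}) : 'M[L]_(d, k) :=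
  \matrix_(i, j) X`_i j.

Lemma row_of_comb d k (X : d.-tuple {ffun 'I_k -> L}) (a : 'rV[F]_d) :
  row_of (\sum_i a 0 i *: X`_i) = a^L *m mx_of X.
Proof.
apply/rowP => j; rewrite !mxE sum_ffunE; apply: eq_bigr => i _.
by rewrite !mxE !ffunE -scalerAl mul1r.
Qed.

Lemma covers_rank_covering d k (X : d.-tuple {ffun 'I_k -> L}) r :
  covers (linear_set <<X>>%VS) r -> rank_covering (mx_of X) r.+1.
Proof.
move=> hr v; have [->|v0] := eqVneq v 0.
  by exists 0, 0; rewrite !mul0mx.
have [|Q [hQ]] := hr <[v]>%VS; first by rewrite /is_point dim_vline v0.
rewrite -memvE => /memv_sumP[vs hvs ->].
have /fin_all_exists[c hc] i : exists c : L * 'rV[F]_d,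
    vs i = c.1 *: (c.2^L *m mx_of X).
  have [u [uU _ Qu]] := hQ i; have := hvs i isT.
  rewrite Qu (coord_span uU) => /vlineP[b ->].
  exists (b, \row_j coord X j u); rewrite -row_of_comb; congr (_ *: row_of _).
  by apply: eq_bigr => j _; rewrite mxE.
exists (\row_i (c i).1), (\matrix_(i, j) (c i).2 0 j).
rewrite -mulmxA mulmx_sum_row; apply: eq_bigr => i _.
rewrite hc mxE row_mul; congr (_ *: (_ *m _)).
by apply/rowP => j; rewrite !mxE.
Qed.

Lemma has_system_rank_covering k rho n :
  (0 < rho)%N -> has_system L k rho n ->
  exists G : 'M[L]_(n, k), rank_covering G rho.
Proof.
move=> r0 [U [[<- _] [hc _]]]; exists (mx_of (vbasis U)).
rewrite -(prednK r0); apply: covers_rank_covering.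
by rewrite (span_basis (vbasisP U)).
Qed.

(** The rows of [G] may be F-dependent, so the system they span can have dimension below [d]. *)
Lemma rank_covering_has_system k rho d (G : 'M[L]_(d, k)) :
  (0 < k)%N -> rank_covering G rho.+1 -> ~ rank_covering G rho ->
  exists2 n, (n <= d)%N & has_system L k rho.+1 n.
Proof.
move=> k0 hG nG.
pose X := [tuple [ffun j => G i j] | i < d] : d.-tuple {ffun 'I_k -> L}.
have XG : mx_of X = G.
  by apply/matrixP => i j; rewrite mxE -tnth_nth tnth_mktuple ffunE.
pose comb (a : 'rV[F]_d) := \sum_i a 0 i *: X`_i.
have combX a : comb a \in <<X>>%VS.
  apply: memv_suml => i _; apply/memvZ/memv_span.
  by rewrite mem_nth // size_tuple.
have repr (v : 'rV[L]_k) :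
    exists (c : 'I_rho.+1 -> L) (a : 'I_rho.+1 -> 'rV[F]_d),
      v = \sum_i c i *: row_of (comb (a i)).
  have [c [A ->]] := hG v; exists (c 0), (fun i => row i A).
  rewrite -mulmxA mulmx_sum_row; apply: eq_bigr => i _.
  by rewrite row_of_comb XG row_mul map_row.
have row_of0 : row_of (0 : {ffun 'I_k -> L}) = 0.
  by apply/rowP => j; rewrite !mxE ffunE.
exists (\dim <<X>>); first by rewrite (leq_trans (dim_span X)) ?size_tuple.
exists <<X>>%VS; split; [split=> // V hV|split].
- apply/eqP; rewrite eqEsubv subvf; apply/subvP => v _.
  by have [c [a ->]] := repr v; apply: memv_suml => i _; apply/memvZ/hV.
(* Only nonzero vectors give points of the linear set, so [u0] will stand in for the combinations
   that vanish. *)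
- have [u0 u0X u0n] : exists2 u0, u0 \in <<X>>%VS & u0 != 0.
    apply: contrapT => no.
    have [c [a /rowP/(_ (Ordinal k0))]] := repr (const_mx 1).
    rewrite big1 => [|i _]; first by rewrite !mxE => /eqP; rewrite oner_eq0.
    have [->|n0] := eqVneq (comb (a i)) 0; first by rewrite row_of0 scaler0.
    by case: no; exists (comb (a i)).
  move=> P /eqP Pp; pose v := vpick P.
  have v0 : v != 0.
    by rewrite vpick0; apply: contraTneq Pp => ->; rewrite dimv0.
  have -> : P = <[v]>%VS.
    by apply/esym/eqP; rewrite eqEdim -memvE memv_pick dim_vline v0 (eqP Pp).
  have [c [a ->]] := repr v.
  pose u i := if comb (a i) == 0 then u0 else comb (a i).
  exists (fun i => <[row_of (u i)]>%VS); split=> [i|].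
    by exists (u i); split=> //; rewrite /u; case: ifPn.
  rewrite -memvE; apply/memv_sumP.
  exists (fun i => c i *: row_of (comb (a i))) => // i _; rewrite /u.
  by case: eqP => [->|_]; rewrite ?row_of0 ?scaler0 ?mem0v // memvZ ?memv_line.
- move=> r /covers_rank_covering; rewrite XG => hr /=.
  by rewrite leqNgt; apply/negP => rr; apply/nG/(rank_coveringW rr hr).
Qed.

(** Only a covering is assumed, whereas [smin] wants [rho] to be minimal. If fewer vectors already
    suffice, [rank_covering_exact] supplies a matrix with no more rows for which [rho] is
    minimal. *)
Lemma smin_le k rho n (G : 'M[L]_(n, k)) :
  (0 < rho <= minn k (\dim {:L}))%N -> rank_covering G rho ->
  (smin L k rho <= n)%N.
Proof.
move=> hrho; have [_ min] := sminP hrho; move: hrho min.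
case: rho => // rho; rewrite leq_min => /and3P[_ rk rL] min hG.
have k0 : (0 < k)%N by case: (k) rk.
have [h|h] := pselect (rank_covering G rho).
  have [d [G' [dn h1 h2]]] := rank_covering_exact rk rL h.
  have [p pd /min] := rank_covering_has_system k0 h1 h2.
  by move/leq_trans; apply; apply: leq_trans dn.
have [p pn /min] := rank_covering_has_system k0 hG h.
by move/leq_trans; apply.
Qed.

Lemma smin_rank_covering k rho :
  (0 < rho <= minn k (\dim {:L}))%N ->
  exists G : 'M[L]_(smin L k rho, k), rank_covering G rho.
Proof.
by move=> h; apply: has_system_rank_covering (sminP h).1; case/andP: h.
Qed.

End Systems.

Local Close Scope ring_scope.

Theorem theorem3p6 (F : finFieldType) (L : fieldExtType F) (m k rho : nat)
    (hm : \dim {: L} = m) (hk : 0 < k) (hrho : 1 <= rho <= minn k m) :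
  [/\ (rho < minn k m -> smin L k (rho + 1) <= smin L k rho),
      smin L k rho + 1 <= smin L (k + 1) rho
    & (rho < m -> smin L (k + 1) (rho + 1) <= smin L k rho + 1)].
Proof.
subst m; have [G hG] := smin_rank_covering hrho.
have /and3P[r0 rk rL] : [&& 0 < rho, rho <= k & rho <= \dim {:L}].
  by rewrite -leq_min.
split=> [lt_rho||lt_rho].
- apply: (smin_le _ (rank_coveringW (leq_addr 1 rho) hG)).
  by rewrite addn1 lt_rho.
- have hrho1 : 0 < rho <= minn k.+1 (\dim {:L}) by rewrite r0 leq_min leqW.
  rewrite !addn1; have [G1 hG1] := smin_rank_covering hrho1.
  (* [G1] has rank [k.+1], hence at least one row, so the predecessor in [rank_covering_project] is
     a true subtraction. *)
  have smin0 : 0 < smin L k.+1 rho.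
    apply: leq_trans (rank_leq_row G1).
    by rewrite (eqP (rank_covering_row_full hG1)).
  have [G2 hG2] := rank_covering_project hG1.
  by rewrite -(prednK smin0) ltnS; apply: smin_le hG2.
- apply: smin_le (rank_covering_block hG).
  by rewrite !addn1 leq_min !ltnS rk lt_rho.
Qed.
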